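(* Let $n\ge 1$ and let $C=(\chi^\lambda_\mu)_{\lambda,\mu\in\mathcal S_n}$ be the supercharacter table of $\mathrm{UT}_n(q)$, with rows and columns indexed by $\mathcal S_n$ in the same order. Then $$\det(C)=(-1)^{\sum_{\lambda\in\mathcal S_n}|\lambda|}\; q^{\sum_{\lambda\in\mathcal S_n}\left(\dim(\lambda)-\mathrm{nst}^\lambda_\lambda\right)}.$$
   Context: For $n\ge 0$, $\mathcal S_n$ denotes the set of set partitions of $\{1,\dots,n\}$, encoded as sets of arcs: a set partition is a subset $\lambda\subseteq\{i\frown j\mid 1\le i<j\le n\}$ (arcs are just pairs $(i,j)$ with $i<j$) such that for all $i<j<k$, $i\frown k\in\lambda$ implies $i\frown j\notin\lambda$ and $j\frown k\notin\lambda$. $|\lambda|$ is the number of arcs. For $\lambda,\mu\in\mathcal S_n$ put $\dim(\lambda)=\sum_{i\frown j\in\lambda}(j-i)$ and $\mathrm{nst}^\lambda_\mu=\#\{i<j<k<l\mid i\frown l\in\lambda,\ j\frown k\in\mu\}$. $\mathrm{UT}_n(q)$ is the group of $n\times n$ unipotent upper triangular matrices over the finite field $\mathbb F_q$. The supercharacter theory used has superclasses the equivalence classes of: $u\sim v$ iff $u=xt(v-1)t^{-1}y+1$ for some $x,y\in\mathrm{UT}_n(q)$ and some invertible diagonal matrix $t$; both superclasses and supercharacters are indexed by $\mathcal S_n$. The value $\chi^\lambda_\mu$ of the supercharacter $\chi^\lambda$ on the superclass indexed by $\mu$ is $$\chi^\lambda_\mu=\frac{(q-1)^{|\lambda|-|\lambda\cap\mu|}\,q^{\dim(\lambda)-|\lambda|}\,(-1)^{|\lambda\cap\mu|}}{q^{\mathrm{nst}^\lambda_\mu}}$$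 if for all $i<j<k$ with $i\frown k\in\lambda$ one has $i\frown j\notin\mu$ and $j\frown k\notin\mu$; and $\chi^\lambda_\mu=0$ otherwise. *)

(* Defs.v *)
From HB Require Import structures.
From mathcomp Require Import all_boot all_order all_algebra all_field.

Set Implicit Arguments.
Unset Strict Implicit.
Unset Printing Implicit Defensive.

Import Order.TTheory GRing.Theory Num.Theory.
Local Open Scope ring_scope.

(* Vertices are 0, ..., n-1 instead of 1, ..., n; the arc from i to j is the  *)
(* pair (i, j).                                                               *)
Definition is_setpart (n : nat) (A : {set 'I_n * 'I_n}) : bool :=
  [forall i : 'I_n, forall j : 'I_n, ((i, j) \in A) ==> (i < j)%N]
  && [forall i : 'I_n, forall j : 'I_n, forall k : 'I_n,
        [&& (i < j)%N, (j < k)%N & (i, k) \in A]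
          ==> ((i, j) \notin A) && ((j, k) \notin A)].

Record setpart (n : nat) :=
  SetPart { arcs :> {set 'I_n * 'I_n}; _ : is_setpart arcs }.

HB.instance Definition _ (n : nat) := [isSub for @arcs n].
HB.instance Definition _ (n : nat) := [Finite of setpart n by <:].

Definition sp_dim (n : nat) (la : setpart n) : nat :=
  (\sum_(a in arcs la) (a.2 - a.1))%N.

Definition nst (n : nat) (la mu : setpart n) : nat :=
  #|[set p : 'I_n * 'I_n * 'I_n * 'I_n |
      let: (i, j, k, l) := p in
      [&& (i < j)%N, (j < k)%N, (k < l)%N,
          (i, l) \in arcs la & (j, k) \in arcs mu]]|.

Definition unitriangular (F : finFieldType) (n : nat) (u : 'M[F]_n) : bool :=
  [forall i : 'I_n, forall j : 'I_n, (j <= i)%N ==> (u i j == (i == j)%:R)].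

Definition superequiv (F : finFieldType) (n : nat) (u v : 'M[F]_n) : bool :=
  [exists x : 'M[F]_n, exists y : 'M[F]_n, exists d : 'rV[F]_n,
    [&& unitriangular x, unitriangular y, diag_mx d \in unitmx
      & u == x *m diag_mx d *m (v - 1%:M) *m invmx (diag_mx d) *m y + 1%:M]].

Definition superclass_rep (F : finFieldType) (n : nat) (mu : setpart n) :
    'M[F]_n :=
  1%:M + \sum_(a in arcs mu) delta_mx a.1 a.2.

Definition superclass (F : finFieldType) (n : nat) (mu : setpart n) :
    {set 'M[F]_n} :=
  [set u | unitriangular u && superequiv u (superclass_rep F mu)].

Definition compatible (n : nat) (la mu : setpart n) : bool :=
  [forall i : 'I_n, forall j : 'I_n, forall k : 'I_n,
    [&& (i < j)%N, (j < k)%N & (i, k) \in arcs la]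
      ==> ((i, j) \notin arcs mu) && ((j, k) \notin arcs mu)].

(* The natural-number subtractions never truncate, since every arc (i, j) has *)
(* j - i >= 1.                                                                *)
Definition supercharacter_value (q n : nat) (la mu : setpart n) : algC :=
  if compatible la mu then
    (q%:R - 1) ^+ (#|arcs la| - #|arcs la :&: arcs mu|)
    * q%:R ^+ (sp_dim la - #|arcs la|)
    * (-1) ^+ #|arcs la :&: arcs mu|
    / q%:R ^+ nst la mu
  else 0.

(* The supercharacter as a function on UT_n(F), expanded in the indicator     *)
(* functions of the superclasses: as these partition UT_n(F), exactly one     *)
(* term is selected when u is unitriangular.                                  *)
Definition supercharacter (F : finFieldType) (n : nat) (la : setpart n)
    (u : 'M[F]_n) : algC :=
  \sum_(mu : setpart n | u \in superclass F mu)
     supercharacter_value #|F| la mu.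

(* e lists the set partitions in an order common to the rows and columns.     *)
Definition supercharacter_table (F : finFieldType) (n N : nat)
    (e : 'I_N -> setpart n) : 'M[algC]_N :=
  \matrix_(a < N, b < N) supercharacter (e a) (superclass_rep F (e b)).

(* Main.v *)
(* The table C factors as A W. The row of W indexed by nu is the q-power sum  *)
(* mu |-> [nu \subset mu] q^-nst(nu, mu), so W is triangular for inclusion,   *)
(* with diagonal q^-nst(nu, nu).                                              *)
(*   For fixed la, C la mu is a product over the arcs a = (i, l) of la, and   *)
(* each factor is -q^(l-i) times the q-power sum of {a} plus a remainder that *)
(* depends only on the arcs of mu properly contained in a. Rank the arcs by a *)
(* linear extension of containment. A function of the arcs of mu of rank < k  *)
(* is a combination of the q-power sums of set partitions with all arcs of    *)
(* rank < k; hence, telescoping over the arcs of la by increasing rank, the   *)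
(* row la of C is (-1)^|la| q^dim(la) times the q-power sum of la plus        *)
(* q-power sums of set partitions that precede la when compared by their      *)
(* largest differing arc. Thus A is triangular too.                           *)
(*   Superclass representatives are inequivalent because x A = B z with x, z  *)
(* unitriangular forces each arc of A to contain one of B and conversely.     *)

Require Import Defs.
From HB Require Import structures.
From mathcomp Require Import all_boot all_order all_algebra all_field.
From mathcomp Require Import perm zify ring.
Set Implicit Arguments.
Unset Strict Implicit.
Unset Printing Implicit Defensive.
Import Order.TTheory GRing.Theory Num.Theory.
Local Open Scope ring_scope.

(** By [det_ranked], both triangular determinants are products of diagonals: [A] contributes
    $(-1)^{|\lambda|}q^{\dim\lambda}$ for each $\lambda$ ([prod_arc_factor_expansion]), and [W]
    contributes $q^{-\mathrm{nst}^\lambda_\lambda}$ ([qpower_sum_diag]). The triangularity of [A]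
    rests on [arc_factor_subE]: replacing an arc factor by its leading term leaves an error blind to
    whether that arc lies in [mu]. By [below_mul_local], such an error involves only set partitions
    of smaller code. Finally, [superclass_rep_superequiv] identifies the table entries with the
    explicit values. *)

(** The rank [f] may have ties, so the arbitrary common order of rows and columns can be kept. *)
Lemma det_ranked (R : comNzRingType) (N : nat) (A : 'M[R]_N)
    (f : 'I_N -> nat) :
  (forall i j, A i j != 0 -> i = j \/ (f j < f i)%N) ->
  \det A = \prod_i A i i.
Proof.
move=> Af; rewrite /determinant (bigD1 (1%g : {perm 'I_N})) //= odd_perm1.
rewrite expr0 mul1r.
rewrite [X in _ + X]big1 ?addr0; first by apply: eq_bigr => i _; rewrite perm1.
move=> s s_neq1.
have [/existsP[i /eqP Ai0]|] := boolP [exists i, A i (s i) == 0].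
  by rewrite (bigD1 i) //= Ai0 mul0r mulr0.
rewrite negb_exists => /forallP A_neq0; case/eqP: s_neq1.
have s_le i : (f (s i) <= f i)%N.
  by case: (Af _ _ (A_neq0 i)) => [<-|/ltnW].
(* A permutation preserves the total rank, so no rank can drop. *)
have /esym/eqP sum_eq : (\sum_i f (s i) = \sum_i f i)%N.
  by rewrite [RHS](reindex_inj (@perm_inj _ s)).
have [_] := leqif_sum (fun i (_ : true) => leqif_eq (s_le i)).
rewrite eq_sym sum_eq => /esym/forallP eq_f.
apply/permP => i; rewrite perm1.
by case: (Af _ _ (A_neq0 i)) => // /ltn_eqF; rewrite (eqP (eq_f i)) eqxx.
Qed.

(** * Unitriangular matrices *)

Lemma unitriangularE (F : finFieldType) (n : nat) (x : 'M[F]_n) (i j : 'I_n) :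
  unitriangular x -> (j <= i)%N -> x i j = (i == j)%:R.
Proof.
by move=> /forallP/(_ i)/forallP/(_ j)/implyP ux le_ji; apply/eqP/ux.
Qed.

Lemma unitriangular_unitmx (F : finFieldType) (n : nat) (x : 'M[F]_n) :
  unitriangular x -> x \in unitmx.
Proof.
move=> ux; have uxE i j := @unitriangularE _ _ _ i j ux.
rewrite unitmxE (@det_ranked _ _ _ (fun i : 'I_n => n - i)%N).
  by rewrite big1 ?unitr1 // => i _; rewrite uxE ?eqxx.
move=> i j; case: (leqP j i) => [/uxE->|lt_ij _].
  by have [->|] := eqVneq i j; [left | rewrite eqxx].
by right; rewrite ltn_sub2l.
Qed.

Lemma unitriangular_invmx (F : finFieldType) (n : nat) (x : 'M[F]_n) :
  unitriangular x -> unitriangular (invmx x).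
Proof.
move=> ux; have xV := mulVmx (unitriangular_unitmx ux).
have uxE i j := @unitriangularE _ _ _ i j ux.
suff inv_le m (i j : 'I_n) :
    (j < m)%N -> (j <= i)%N -> invmx x i j = (i == j)%:R.
  by apply/forallP => i; apply/forallP => j; apply/implyP => le_ji;
    rewrite (inv_le j.+1).
(* In entry $(i,j)$ of $x^{-1}x$, the terms with $k>j$ vanish because of [x], and those with $k<j$
   by induction. *)
elim: m i j => // m IHm i j; rewrite ltnS => le_jm le_ji.
have /matrixP/(_ i j) := xV; rewrite !mxE (bigD1 j) //= uxE // eqxx mulr1.
rewrite big1 ?addr0 // => k neq_kj.
have [le_jk|lt_kj] := leqP j k; first by rewrite uxE // (negPf neq_kj) mulr0.
rewrite IHm ?(leq_trans lt_kj) ?(ltnW (leq_trans lt_kj le_ji)) //.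
suff /negPf-> : i != k by rewrite mul0r.
by apply: contraTneq lt_kj => <-; rewrite -leqNgt.
Qed.

(** * Set partitions and inequivalence of superclass representatives *)

Section SetPartitions.

Variable n : nat.
Implicit Types (a b : 'I_n * 'I_n) (la mu nu : setpart n).
Implicit Type A : {set 'I_n * 'I_n}.

Lemma setpart_lt la i j : (i, j) \in arcs la -> (i < j)%N.
Proof.
by case: la => A /andP[/forallP/(_ i)/forallP/(_ j)/implyP lt_ij _] /lt_ij.
Qed.

Lemma setpart_injl la i j k :
  (i, j) \in arcs la -> (i, k) \in arcs la -> j = k.
Proof.
case: la => A sA /= Aij Aik.
wlog lt_jk : j k Aij Aik / (j < k)%N.
  move=> th; case: (ltngtP j k) => [||/val_inj//]; first exact: th.
  by move=> lt_kj; apply/esym/th.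
have lt_ij := @setpart_lt (SetPart sA) i j Aij.
have /andP[_ /forallP/(_ i)/forallP/(_ j)/forallP/(_ k)] := sA.
by rewrite lt_ij lt_jk Aik Aij.
Qed.

Lemma setpart_injr la i j k :
  (i, k) \in arcs la -> (j, k) \in arcs la -> i = j.
Proof.
case: la => A sA /= Aik Ajk.
wlog lt_ij : i j Aik Ajk / (i < j)%N.
  move=> th; case: (ltngtP i j) => [||/val_inj//]; first exact: th.
  by move=> lt_ji; apply/esym/th.
have lt_jk := @setpart_lt (SetPart sA) j k Ajk.
have /andP[_ /forallP/(_ i)/forallP/(_ j)/forallP/(_ k)] := sA.
by rewrite lt_ij lt_jk Aik Ajk andbF.
Qed.

Lemma is_setpart_sub A la : A \subset arcs la -> is_setpart A.
Proof.
case: la => B /= /andP[/forallP ltB /forallP confB] /subsetP sAB.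
apply/andP; split; apply/forallP => i; apply/forallP => j.
  by apply/implyP => /sAB; move/forallP/(_ j)/implyP: (ltB i).
apply/forallP => k; apply/implyP => /and3P[lt_ij lt_jk /sAB Bik].
have /forallP/(_ j)/forallP/(_ k) := confB i; rewrite lt_ij lt_jk Bik /=.
by case/andP=> Bij Bjk; rewrite !(contra (sAB _)).
Qed.

(** At an arc of [la], the column of [A] has no other nonzero entry, so [x *m A] keeps this entry;
    read in [B *m z], it yields an arc of [mu] inside the given one with the same left end.
    Symmetrically, each arc of [mu] contains an arc of [la] with the same right end. A strictly
    shorter arc would by induction lie in both partitions, which the shared endpoint forbids. *)
Lemma supp_unitriangular_equiv (F : finFieldType) (x z A B : 'M[F]_n) la mu :
  unitriangular x -> unitriangular z -> x *m A = B *m z ->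
  (forall i j, (A i j != 0) = ((i, j) \in arcs la)) ->
  (forall i j, (B i j != 0) = ((i, j) \in arcs mu)) ->
  la = mu.
Proof.
move=> ux uz xAz suppA suppB; apply/val_inj/setP => -[i j] /=.
have uxE i' j' := @unitriangularE _ _ _ i' j' ux.
have uzE i' j' := @unitriangularE _ _ _ i' j' uz.
have xA (i' j' : 'I_n) : (i', j') \in arcs la -> (x *m A) i' j' != 0.
  move=> la_ij; rewrite mxE (bigD1 i') //= uxE // eqxx mul1r big1 ?addr0.
    by rewrite suppA.
  move=> k neq_k; have [->|] := eqVneq (A k j') 0; first by rewrite mulr0.
  by rewrite suppA => /(setpart_injr la_ij) eq_k; rewrite eq_k eqxx in neq_k.
have Bz (i' j' : 'I_n) : (i', j') \in arcs mu -> (B *m z) i' j' != 0.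
  move=> mu_ij; rewrite mxE (bigD1 j') //= uzE // eqxx mulr1 big1 ?addr0.
    by rewrite suppB.
  move=> k neq_k; have [->|] := eqVneq (B i' k) 0; first by rewrite mul0r.
  by rewrite suppB => /(setpart_injl mu_ij) eq_k; rewrite eq_k eqxx in neq_k.
have la_mu (i' j' : 'I_n) : (i', j') \in arcs la ->
    exists2 k : 'I_n, (i', k) \in arcs mu & (k <= j')%N.
  move/xA; rewrite xAz mxE => sum_neq0.
  have [/existsP[k /andP[mu_k le_k]]|] :=
    boolP [exists k : 'I_n, ((i', k) \in arcs mu) && (k <= j')%N];
    first by exists k.
  rewrite negb_exists => /forallP no_k; case/eqP: sum_neq0; apply: big1 => k _.
  have := no_k k; rewrite -suppB negb_and negbK => /orP[/eqP->|lt_jk];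
    first by rewrite mul0r.
  rewrite uzE; last by lia.
  by case: eqP lt_jk => [->|]; rewrite ?mulr0 // leqnn.
have mu_la (i' j' : 'I_n) : (i', j') \in arcs mu ->
    exists2 k : 'I_n, (k, j') \in arcs la & (i' <= k)%N.
  move/Bz; rewrite -xAz mxE => sum_neq0.
  have [/existsP[k /andP[la_k le_k]]|] :=
    boolP [exists k : 'I_n, ((k, j') \in arcs la) && (i' <= k)%N];
    first by exists k.
  rewrite negb_exists => /forallP no_k; case/eqP: sum_neq0; apply: big1 => k _.
  have := no_k k; rewrite -suppA negb_and negbK => /orP[/eqP->|lt_ki];
    first by rewrite mulr0.
  rewrite uxE; last by lia.
  by case: eqP lt_ki => [->|]; rewrite ?mul0r // leqnn.
(* Both inclusions at once, by induction on the length of the arc. *)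
have [m] := ubnP (j - i); elim: m i j => // m IHm i j; rewrite ltnS => le_m.
apply/idP/idP => [la_ij|mu_ij].
  have [k mu_ik le_kj] := la_mu _ _ la_ij.
  have [lt_kj|] := ltnP k j; last by move=> le_jk; rewrite (_ : j = k) //;
    apply/ord_inj; lia.
  have lt_ik := setpart_lt mu_ik.
  move: mu_ik; rewrite -(IHm i k); last by lia.
  by move/(setpart_injl la_ij) => eq_jk; rewrite eq_jk ltnn in lt_kj.
have [k la_kj le_ik] := mu_la _ _ mu_ij.
have [lt_ik|] := ltnP i k; last by move=> le_ki; rewrite (_ : i = k) //;
  apply/ord_inj; lia.
have lt_kj := setpart_lt la_kj.
move: la_kj; rewrite (IHm k j); last by lia.
by move/(setpart_injr mu_ij) => eq_ik; rewrite eq_ik ltnn in lt_ik.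
Qed.

Lemma superclass_repE (F : finFieldType) mu i j :
  (superclass_rep F mu - 1%:M) i j = ((i, j) \in arcs mu)%:R.
Proof.
rewrite /superclass_rep addrC addKr summxE.
have [mu_ij|mu'ij] := boolP ((i, j) \in arcs mu).
  rewrite (bigD1 (i, j)) //= mxE !eqxx big1 ?addr0 // => -[i' j'] /andP[_ neq].
  by rewrite mxE; move: neq; rewrite eq_sym xpair_eqE /= => /negPf->.
apply: big1 => -[i' j'] mu_ij'; rewrite mxE /=.
case: eqP => // eq_i; case: eqP => // eq_j.
by rewrite eq_i eq_j mu_ij' in mu'ij.
Qed.

Lemma superclass_rep_unitriangular (F : finFieldType) mu :
  unitriangular (superclass_rep F mu).
Proof.
apply/forallP => i; apply/forallP => j; apply/implyP => le_ji.
have -> : superclass_rep F mu i j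
    = (superclass_rep F mu - 1%:M) i j + (i == j)%:R.
  by rewrite -[in LHS](subrK 1%:M (superclass_rep F mu)) mxE [1%:M i j]mxE.
rewrite superclass_repE; suff /negPf-> : (i, j) \notin arcs mu by rewrite add0r.
by apply/negP => /setpart_lt; rewrite ltnNge le_ji.
Qed.

Lemma unitriangular1 (F : finFieldType) : unitriangular (1%:M : 'M[F]_n).
Proof. by apply/forallP => i; apply/forallP => j; rewrite mxE eqxx implybT. Qed.

Lemma superclass_rep_superequiv (F : finFieldType) la mu :
  superequiv (superclass_rep F la) (superclass_rep F mu) = (la == mu).
Proof.
apply/idP/eqP => [|->]; last first.
  apply/existsP; exists 1%:M; apply/existsP; exists 1%:M.
  apply/existsP; exists (const_mx 1).
  rewrite unitriangular1 diag_const_mx unitmx1 invmx1 !mul1mx !mulmx1 subrK.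
  by rewrite eqxx.
case/existsP => x /existsP[y /existsP[d /and4P[ux uy ud /eqP la_mu]]].
have d_neq0 i : d 0 i != 0.
  by move: ud; rewrite unitmxE det_diag unitfE => /prodf_neq0; apply.
set N := superclass_rep F mu - 1%:M in la_mu *.
have NE i j : N i j = ((i, j) \in arcs mu)%:R by exact: superclass_repE.
clearbody N.
(* Diagonal conjugation rescales entries without changing the support; moving [y] to the other side
   then gives the equation of [supp_unitriangular_equiv]. *)
set A := diag_mx d *m N *m invmx (diag_mx d).
have suppA i j : (A i j != 0) = ((i, j) \in arcs mu).
  have /matrixP/(_ i j) : A *m diag_mx d = diag_mx d *m N by rewrite mulmxKV.
  rewrite mul_mx_diag mul_diag_mx mxE [RHS]mxE NE => Aij.
  rewrite -(mulIr_eq0 _ (mulIf (d_neq0 j))) Aij mulf_eq0 (negPf (d_neq0 i)).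
  by case: (_ \in _); rewrite ?oner_eq0 ?eqxx.
have suppB i j : ((superclass_rep F la - 1%:M) i j != 0) = ((i, j) \in arcs la).
  by rewrite superclass_repE; case: (_ \in _); rewrite ?oner_eq0 ?eqxx.
have uyV := unitriangular_invmx uy.
apply/esym; apply: (supp_unitriangular_equiv ux uyV _ suppA suppB).
by rewrite la_mu addrK mulmxK ?unitriangular_unitmx // !mulmxA.
Qed.

Lemma supercharacter_rep (F : finFieldType) la mu :
  supercharacter la (superclass_rep F mu) = supercharacter_value #|F| la mu.
Proof.
rewrite /supercharacter (eq_bigl (pred1 mu)) ?big_pred1_eq // => nu.
by rewrite inE superclass_rep_unitriangular superclass_rep_superequiv /= eq_sym.
Qed.

(** * Containment of arcs and a linear extension of it *)

Definition nested a b := [&& a.1 < b.1, b.1 < b.2 & b.2 < a.2]%N.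

Definition conflict a b :=
  (b.1 == a.1) && (b.2 < a.2)%N || (b.2 == a.2) && (a.1 < b.1)%N.

Definition nest mu a : nat := (\sum_(b in arcs mu) nested a b)%N.

Lemma nst_sum la mu : nst la mu = (\sum_(a in arcs la) nest mu a)%N.
Proof.
pose h (p : ('I_n * 'I_n) * ('I_n * 'I_n)) := (p.1.1, p.2.1, p.2.2, p.1.2).
pose h' (p : 'I_n * 'I_n * 'I_n * 'I_n) :=
  let: (i, j, k, l) := p in ((i, l), (j, k)).
rewrite /nst /nest pair_big -sum1_card.
rewrite (reindex h) /=; last first.
  by exists h' => -[] => [[? ?] [? ?]|[[? ?] ?] ?].
rewrite big_mkcond [RHS]big_mkcond; apply: eq_bigr => -[[i l] [j k]] _ /=.
rewrite inE /nested /=.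
by do 5?[case: (_ \in _); rewrite ?andbF ?andbT //=]; case: ifP => // /negPf->.
Qed.

Lemma compatibleE la mu :
  compatible la mu =
    [forall a in arcs la, forall b in arcs mu, ~~ conflict a b].
Proof.
apply/idP/idP => [/forallP c|].
  apply/forall_inP => -[i k] la_ik; apply/forall_inP => -[j l] mu_jl.
  rewrite /conflict /=; have lt_jl := setpart_lt mu_jl.
  apply/negP => /orP[/andP[/eqP eq_ji lt_lk]|/andP[/eqP eq_lk lt_ij]].
    have /forallP/(_ l)/forallP/(_ k) := c i.
    by rewrite -eq_ji lt_jl lt_lk eq_ji la_ik -eq_ji mu_jl.
  have /forallP/(_ j)/forallP/(_ k) := c i.
  by rewrite -eq_lk lt_jl lt_ij eq_lk la_ik -eq_lk mu_jl andbF.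
move=> /forall_inP c.
apply/forallP => i; apply/forallP => j; apply/forallP => k.
apply/implyP => /and3P[lt_ij lt_jk la_ik]; have /forall_inP cik := c _ la_ik.
apply/andP; split; apply/negP => /cik; rewrite /conflict /= !eqxx /=.
  by rewrite lt_jk.
by rewrite lt_ij orbT.
Qed.

(** Lexicographic: increasing right end, then decreasing left end. The second digit runs from 1 to
    [n], so base [n] still separates arcs. *)
Definition rank a : nat := (a.2 * n + (n - a.1))%N.

Lemma rank_lt a b : (b.2 < a.2)%N -> (rank b < rank a)%N.
Proof.
move=> lt_ba; have := ltn_ord a.1; rewrite /rank.
have : ((b.2).+1 * n <= a.2 * n)%N by rewrite leq_mul2r lt_ba orbT.
by rewrite mulSn; lia.
Qed.

Lemma rank_inj : injective rank.
Proof.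
move=> a b eq_ab; have eq2 : a.2 = b.2.
  by case: (ltngtP a.2 b.2) => [/rank_lt|/rank_lt|/ord_inj//];
    rewrite eq_ab ltnn.
move: eq_ab; rewrite /rank eq2 => eq1; case: a b eq1 eq2 => [i j] [i' j'] /=.
have := ltn_ord i; have := ltn_ord i' => lt_i' lt_i eq1 ->.
by congr pair; apply/ord_inj; lia.
Qed.

Lemma rank_nested a b : nested a b -> (rank b < rank a)%N.
Proof. by case/and3P=> _ _ /rank_lt. Qed.

Lemma rank_conflict a b : conflict a b -> (rank b < rank a)%N.
Proof.
case/orP=> /andP[]; first by move=> _ /rank_lt.
by move=> /eqP eq2 lt1; have := ltn_ord a.1; rewrite /rank eq2; lia.
Qed.

(** Invariance under [low k] is how a function is said to depend only on the arcs of rank below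
    [k]. *)
Definition low k mu : setpart n :=
  SetPart (is_setpart_sub (subsetIl (arcs mu) [set a | (rank a < k)%N])).

Lemma in_low k mu a :
  (a \in arcs (low k mu)) = (a \in arcs mu) && (rank a < k)%N.
Proof. by rewrite !inE. Qed.

Lemma nest_low k mu a : (rank a <= k)%N -> nest (low k mu) a = nest mu a.
Proof.
move=> le_ak; rewrite /nest big_mkcond [RHS]big_mkcond; apply: eq_bigr => b _.
rewrite in_low; case: (_ \in _) => //=.
have [/rank_nested lt_ba|] := boolP (nested a b); last by rewrite if_same.
by rewrite (leq_trans lt_ba le_ak).
Qed.

Lemma low_id k mu :
  (forall a, a \in arcs mu -> (rank a < k)%N) -> low k mu = mu.
Proof.
move=> mu_lt; apply/val_inj/setP => a /=.
rewrite -[LHS]/(a \in arcs (low k mu)).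
by rewrite in_low; case: (boolP (a \in _)) => //= /mu_lt.
Qed.

(** * Expansions in q-power sums *)

Section Expansion.

Variables (K : fieldType) (q : K).
Hypothesis q_neq0 : q != 0.
Implicit Types (f g : setpart n -> K).

(** [A] is any set of arcs, so that unions can be formed before knowing whether they are set
    partitions. *)
Definition qpower_sum A mu : K :=
  \prod_(a in A) ((a \in arcs mu)%:R / q ^+ nest mu a).

Lemma qpower_sum_neq0 A mu : (qpower_sum A mu != 0) = (A \subset arcs mu).
Proof.
apply/idP/subsetP => [/prodf_neq0 AP a /AP | sAmu].
  by apply: contraTT => /negPf->; rewrite mul0r negbK.
by apply/prodf_neq0 => a /sAmu->; rewrite mul1r invr_eq0 expf_neq0.
Qed.

Lemma qpower_sum_eq0 A mu : ~~ (A \subset arcs mu) -> qpower_sum A mu = 0.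
Proof. by rewrite -qpower_sum_neq0 negbK => /eqP. Qed.

Lemma qpower_sum_diag mu : qpower_sum (arcs mu) mu = (q ^+ nst mu mu)^-1.
Proof.
rewrite nst_sum -prodrXr -prodfV; apply: eq_bigr => a ->.
by rewrite mul1r.
Qed.

Lemma qpower_sum_low k A mu :
  (forall a, a \in A -> (rank a < k)%N) ->
  qpower_sum A (low k mu) = qpower_sum A mu.
Proof.
move=> A_lt; apply: eq_bigr => a /A_lt lt_ak.
by rewrite in_low lt_ak andbT nest_low // ltnW.
Qed.

Lemma qpower_sumU A A' mu : [disjoint A & A'] ->
  qpower_sum (A :|: A') mu = qpower_sum A mu * qpower_sum A' mu.
Proof.
by move=> dAA'; rewrite /qpower_sum -bigU //; apply: eq_bigl => a; rewrite !inE.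
Qed.

(** The coefficients solve a system triangular for inclusion, by increasing number of arcs; its
    diagonal entries [qpower_sum (arcs nu) nu] are nonzero. *)
Lemma local_expansion k f : (forall mu, f (low k mu) = f mu) ->
  exists2 c : setpart n -> K, forall nu, c nu != 0 -> low k nu = nu
    & forall mu, f mu = \sum_nu c nu * qpower_sum (arcs nu) mu.
Proof.
move=> f_low.
suff ind s : exists2 c : setpart n -> K, forall nu, c nu != 0 -> low k nu = nu
    & forall mu, low k mu = mu -> (#|arcs mu| < s)%N ->
        f mu = \sum_nu c nu * qpower_sum (arcs nu) mu.
  have [c c_low c_f] := ind #|{: 'I_n * 'I_n}|.+1; exists c => // mu.
  rewrite -f_low c_f ?ltnS ?max_card //; last first.
    by apply: low_id => a; rewrite in_low => /andP[].
  apply: eq_bigr => nu _; have [->|/c_low nu_low] := eqVneq (c nu) 0.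
    by rewrite !mul0r.
  by rewrite qpower_sum_low // => a; rewrite -nu_low in_low => /andP[].
elim: s => [|s [c c_low c_f]]; first by exists (fun=> 0) => // nu; rewrite eqxx.
(* The defect of the previous expansion at [nu], divided by the diagonal entry. This correction
   vanishes at every other [mu] with at most [s] arcs. *)
pose d nu := if (low k nu == nu) && (#|arcs nu| == s) then
  (f nu - \sum_rho c rho * qpower_sum (arcs rho) nu) / qpower_sum (arcs nu) nu
  else 0.
exists (fun nu => c nu + d nu) => [nu | mu mu_low].
  have [/eqP|neq_nu] := boolP (low k nu == nu); first by [].
  rewrite /d (negPf neq_nu) addr0 => /c_low eq_nu.
  by rewrite eq_nu eqxx in neq_nu.
rewrite ltnS => le_s.
under eq_bigr do rewrite mulrDl; rewrite big_split /=.
have d0 nu : nu != mu -> d nu * qpower_sum (arcs nu) mu = 0.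
  move=> neq; rewrite /d; case: ifP => [/andP[_ /eqP card_nu]|];
    last by rewrite mul0r.
  rewrite (@qpower_sum_eq0 _ mu) ?mulr0 //; apply: contra neq => sub.
  by apply/eqP/val_inj/eqP; rewrite eqEcard sub /= card_nu.
rewrite [X in _ + X](bigD1 mu) //= [X in _ + (_ + X)]big1 // addr0.
rewrite /d mu_low eqxx /=; case: eqP => [_|/eqP neq_s].
  by rewrite divfK ?qpower_sum_neq0 // addrCA subrr addr0.
by rewrite mul0r addr0 c_f // ltn_neqAle neq_s.
Qed.

(* The base exceeds the number of arcs, so that codes compare set partitions  *)
(* by their arc of largest rank at which they differ.                         *)
Definition code mu : nat :=
  (\sum_(a in arcs mu) #|{: 'I_n * 'I_n}|.+1 ^ rank a)%N.

Lemma code_lt la nu m : m \in arcs la ->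
  (forall a, a \in arcs nu -> (rank a < rank m)%N \/
     (rank m < rank a)%N /\ a \in arcs la) ->
  (code nu < code la)%N.
Proof.
move=> la_m nuP; rewrite /code; set B := #|_|.+1.
rewrite [X in (X < _)%N](big_setID [set a | (rank a < rank m)%N]) /=.
rewrite [X in (_ < X)%N](bigD1 m) //=.
rewrite -addSn; apply: leq_add.
  (* Multiplying by the base avoids the truncated exponent [rank m - 1]: each low arc then weighs at
     most [B ^ rank m], and there are fewer than [B] of them. *)
  rewrite -(ltn_pmul2l (isT : 0 < B)%N) -expnS big_distrr /=.
  apply: (@leq_ltn_trans
    (\sum_(a in arcs nu :&: [set a | (rank a < rank m)%N]) B ^ rank m)%N).
    apply: leq_sum => a; rewrite !inE => /andP[_ lt_am].
    by rewrite -expnS leq_pexp2l.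
  by rewrite sum_nat_const expnS ltn_pmul2r ?expn_gt0 // /B ltnS max_card.
rewrite big_mkcond [X in (_ <= X)%N]big_mkcond; apply: leq_sum => a _.
rewrite !inE; case: ifP => // /andP[]; rewrite -leqNgt => le_ma /nuP[|].
  by rewrite ltnNge le_ma.
by case=> lt_ma ->; case: eqP => // eq_am; rewrite eq_am ltnn in lt_ma.
Qed.

(** The span of the q-power sums of smaller code than [la], that is, what may stand off the diagonal
    in the row of [A] at [la]. *)
Definition below la f :=
  exists2 c : setpart n -> K, forall nu, c nu != 0 -> (code nu < code la)%N
    & forall mu, f mu = \sum_nu c nu * qpower_sum (arcs nu) mu.

Lemma below_ext la f g : f =1 g -> below la f -> below la g.
Proof. by move=> fg [c c_la cf]; exists c => // mu; rewrite -fg. Qed.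

Lemma below0 la : below la (fun=> 0).
Proof.
exists (fun=> 0) => [nu | mu]; first by rewrite eqxx.
by rewrite big1 // => nu _; rewrite mul0r.
Qed.

Lemma belowD la f g :
  below la f -> below la g -> below la (fun mu => f mu + g mu).
Proof.
move=> [c c_la cf] [d d_la dg]; exists (fun nu => c nu + d nu) => [nu | mu].
  have [/eqP|/c_la//] := boolP (c nu == 0).
  by move=> ->; rewrite add0r => /d_la.
by rewrite cf dg -big_split; apply: eq_bigr => nu _; rewrite mulrDl.
Qed.

Lemma belowZ la (z : K) f : below la f -> below la (fun mu => z * f mu).
Proof.
move=> [c c_la cf]; exists (fun nu => z * c nu) => [nu | mu].
  by rewrite mulf_eq0 negb_or => /andP[_ /c_la].
by rewrite cf big_distrr; apply: eq_bigr => nu _; rewrite /= mulrA.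
Qed.

Lemma below_sum la (I : Type) (r : seq I) (f : I -> setpart n -> K) :
  (forall i, below la (f i)) -> below la (fun mu => \sum_(i <- r) f i mu).
Proof.
move=> f_la; elim: r => [|i r IHr].
  by apply: below_ext (below0 la) => mu; rewrite big_nil.
by apply: below_ext (belowD (f_la i) IHr) => mu; rewrite big_cons.
Qed.

Lemma below_qpower_sum la nu :
  (code nu < code la)%N -> below la (qpower_sum (arcs nu)).
Proof.
move=> lt_nu; exists (fun rho => (rho == nu)%:R) => [rho | mu].
  by case: (eqVneq rho nu) => [->|]; rewrite ?eqxx.
rewrite (bigD1 nu) //= eqxx mul1r big1 ?addr0 // => rho /negPf neq_rho.
by rewrite neq_rho mul0r.
Qed.

(** Expanding [f] gives q-power sums of unions of the upper arcs of [la] with a set partition of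
    rank below [m]. If the union is a set partition, its code is smaller since it lacks [m];
    otherwise no [mu] contains it and its q-power sum is zero. *)
Lemma below_mul_local la m f : m \in arcs la ->
  (forall mu, f (low (rank m) mu) = f mu) ->
  below la (fun mu =>
    qpower_sum [set a in arcs la | (rank m < rank a)%N] mu * f mu).
Proof.
move=> la_m /local_expansion[c c_low cf]; set U := [set a in _ | _].
suff nu_la nu : below la (fun mu =>
    c nu * (qpower_sum U mu * qpower_sum (arcs nu) mu)).
  apply: below_ext (below_sum (index_enum (setpart n)) nu_la) => mu.
  rewrite cf big_distrr; apply: eq_bigr => nu _ /=; exact: mulrCA.
have [->|/c_low nu_low] := eqVneq (c nu) 0.
  by apply: below_ext (below0 la) => mu; rewrite mul0r.
have nu_lt a : a \in arcs nu -> (rank a < rank m)%N.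
  by rewrite -nu_low in_low => /andP[].
apply: belowZ; have dU : [disjoint U & arcs nu].
  rewrite disjoint_subset; apply/subsetP => a; rewrite !inE => /andP[_ lt_ma].
  by apply: contraL lt_ma => /nu_lt lt_am; rewrite -leqNgt ltnW.
have [sU|not_sU] := boolP (is_setpart (U :|: arcs nu)); last first.
  apply: below_ext (below0 la) => mu; rewrite -qpower_sumU // qpower_sum_eq0 //.
  by apply: contra not_sU => /is_setpart_sub.
apply: below_ext (below_qpower_sum (nu := SetPart sU) _) => [mu | ].
  by rewrite qpower_sumU.
apply: (code_lt la_m) => a; rewrite !inE => /orP[/andP[la_a lt_ma]|/nu_lt];
  last by left.
by right.
Qed.

(** * Arc factors and their leading terms *)

Definition lead_factor mu a : K :=
  - q ^+ (a.2 - a.1) * ((a \in arcs mu)%:R / q ^+ nest mu a).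

Definition arc_factor mu a : K :=
  if [exists b in arcs mu, conflict a b] then 0
  else (if a \in arcs mu then -1 else q - 1) * q ^+ (a.2 - a.1).-1
       / q ^+ nest mu a.

(** For [a] in [mu], no arc of [mu] conflicts with [a], and $-q^{d-1}+q^d=(q-1)q^{d-1}$ for an arc
    of length $d$: the same value as for [a] outside [mu] without conflict. *)
Lemma arc_factor_subE mu a : (a.1 < a.2)%N ->
  arc_factor mu a - lead_factor mu a =
    if [exists b in arcs mu, conflict a b] then 0
    else (q - 1) * q ^+ (a.2 - a.1).-1 / q ^+ nest mu a.
Proof.
rewrite -subn_gt0 => len_gt0; rewrite /arc_factor /lead_factor.
rewrite -[in X in - (- X * _)](prednK len_gt0) exprS.
have [mu_a|_] := boolP (a \in arcs mu); last by rewrite mul0r mulr0 subr0.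
case: ifP => [/exists_inP[b mu_b]|_].
  case: a b mu_a mu_b {len_gt0} => [i j] [i' j'] /= mu_a mu_b.
  case/orP=> /andP[/eqP /= eq_ij].
    by rewrite eq_ij in mu_b; rewrite (setpart_injl mu_a mu_b) ltnn.
  by rewrite eq_ij in mu_b; rewrite (setpart_injr mu_a mu_b) ltnn.
by rewrite mul1r mulN1r !mulNr opprK !mulrBl mul1r addrC.
Qed.

Lemma conflict_low k mu a : (rank a <= k)%N ->
  [exists b in arcs (low k mu), conflict a b] =
  [exists b in arcs mu, conflict a b].
Proof.
move=> le_ak; apply/exists_inP/exists_inP => -[b mu_b ab]; exists b => //.
  by move: mu_b; rewrite in_low => /andP[].
by rewrite in_low mu_b (leq_trans (rank_conflict ab)).
Qed.

Lemma arc_factor_low k mu a : (rank a < k)%N ->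
  arc_factor (low k mu) a = arc_factor mu a.
Proof.
move=> lt_ak; have le_ak := ltnW lt_ak.
by rewrite /arc_factor conflict_low // in_low lt_ak andbT nest_low.
Qed.

Lemma arc_factor_sub_low k mu a : (a.1 < a.2)%N -> (rank a <= k)%N ->
  arc_factor (low k mu) a - lead_factor (low k mu) a =
  arc_factor mu a - lead_factor mu a.
Proof.
by move=> lt_a le_ak; rewrite !arc_factor_subE // conflict_low // nest_low.
Qed.

Lemma prod_lead_factor A mu : \prod_(a in A) lead_factor mu a =
  (\prod_(a in A) - q ^+ (a.2 - a.1)) * qpower_sum A mu.
Proof. exact: big_split. Qed.

(* Telescoping: the arc factors are replaced by their leading terms one arc   *)
(* at a time, in order of increasing rank.                                    *)
Lemma below_telescope la k :
  below la (fun mu =>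
    \prod_(a in arcs la | (rank a < k)%N) arc_factor mu a
    * \prod_(a in arcs la | (k <= rank a)%N) lead_factor mu a
    - \prod_(a in arcs la) lead_factor mu a).
Proof.
elim: k => [|k IHk].
  apply: below_ext (below0 la) => mu.
  rewrite big_pred0 => [|a]; last by rewrite ltn0 andbF.
  by rewrite mul1r (eq_bigl (mem (arcs la))) ?subrr // => a;
    rewrite leq0n andbT.
pose D mu :=
    \prod_(a in arcs la | (rank a < k.+1)%N) arc_factor mu a
    * \prod_(a in arcs la | (k.+1 <= rank a)%N) lead_factor mu a
  - \prod_(a in arcs la | (rank a < k)%N) arc_factor mu a
    * \prod_(a in arcs la | (k <= rank a)%N) lead_factor mu a.
suff D_la : below la D.
  by apply: below_ext (belowD D_la IHk) => mu; rewrite /D addrA subrK.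
have [/existsP[m /andP[la_m /eqP rk_m]]|no_m] :=
    boolP [exists m, (m \in arcs la) && (rank m == k)]; last first.
  apply: below_ext (below0 la) => mu; apply/esym/eqP; rewrite subr_eq0.
  have neq a : a \in arcs la -> rank a != k.
    move: no_m; rewrite negb_exists => /forallP/(_ a).
    by rewrite negb_and => /orP[/negPf->|].
  apply/eqP; congr (_ * _); apply: eq_bigl => a.
    case: (boolP (a \in _)) => //= /neq.
    by rewrite ltnS leq_eqVlt => /negPf->.
  case: (boolP (a \in _)) => //= /neq.
  by rewrite [(k <= _)%N]leq_eqVlt eq_sym => /negPf->.
(* The error at [m] and the arc factors of smaller rank all ignore the arcs of rank at least
   [rank m]; the remaining factors are leading terms, a scalar times a q-power sum. *)
pose f mu := (arc_factor mu m - lead_factor mu m)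
  * \prod_(a in arcs la | (rank a < k)%N) arc_factor mu a.
have f_low mu : f (low (rank m) mu) = f mu.
  rewrite /f arc_factor_sub_low //; last by case: (m) la_m => i j /setpart_lt.
  by congr (_ * _); apply: eq_bigr => a /andP[_ lt_ak];
    rewrite arc_factor_low ?rk_m.
apply: below_ext (belowZ (\prod_(a in [set a in arcs la | (rank m < rank a)%N])
  - q ^+ (a.2 - a.1)) (below_mul_local la_m f_low)) => mu.
rewrite mulrA -prod_lead_factor /f /D.
have neq_rk a : (a != m) = (rank a != k) by rewrite -rk_m (inj_eq rank_inj).
have -> : \prod_(a in arcs la | (rank a < k.+1)%N) arc_factor mu a =
    arc_factor mu m * \prod_(a in arcs la | (rank a < k)%N) arc_factor mu a.
  rewrite (bigD1 m) ?la_m ?rk_m //=; congr (_ * _); apply: eq_bigl => a.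
  by rewrite neq_rk [(_ < k)%N]ltn_neqAle ltnS -andbA [(_ <= _)%N && _]andbC.
have -> : \prod_(a in arcs la | (k <= rank a)%N) lead_factor mu a =
    lead_factor mu m * \prod_(a in arcs la | (k < rank a)%N) lead_factor mu a.
  rewrite (bigD1 m) ?la_m ?rk_m //=; congr (_ * _); apply: eq_bigl => a.
  by rewrite neq_rk [(k < _)%N]ltn_neqAle eq_sym -andbA [(_ <= _)%N && _]andbC.
rewrite (eq_bigl (fun a => (a \in arcs la) && (k < rank a)%N)) => [|a];
  last first.
  by rewrite inE rk_m.
ring.
Qed.

Lemma prod_arc_factor_expansion la :
  exists c : setpart n -> K,
  [/\ forall mu, \prod_(a in arcs la) arc_factor mu a =
        \sum_nu c nu * qpower_sum (arcs nu) mu,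
      c la = \prod_(a in arcs la) - q ^+ (a.2 - a.1)
    & forall nu, c nu != 0 -> nu = la \/ (code nu < code la)%N].
Proof.
(* Past the largest rank in [la], every leading term has been replaced by its arc factor. *)
have [c c_la cE] := below_telescope la (\max_(a in arcs la) rank a).+1.
exists (fun nu =>
  c nu + (nu == la)%:R * \prod_(a in arcs la) - q ^+ (a.2 - a.1)).
split=> [mu | | nu].
- under [RHS]eq_bigr do rewrite mulrDl; rewrite big_split /= -cE.
  rewrite [X in _ + X](bigD1 la) //= eqxx mul1r [X in _ + (_ + X)]big1 =>
    [|nu /negPf->]; last by rewrite !mul0r.
  rewrite addr0 -prod_lead_factor subrK.
  rewrite [X in _ * X]big_pred0 => [|a].
    rewrite mulr1; apply: eq_bigl => a; case: (boolP (a \in _)) => //= la_a.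
    by rewrite ltnS leq_bigmax_cond.
  case: (boolP (a \in _)) => //= la_a; apply/negbTE.
  by rewrite -leqNgt leq_bigmax_cond.
- rewrite eqxx mul1r; have [->|/c_la] := eqVneq (c la) 0;
  first by rewrite add0r.
  by rewrite ltnn.
- have [->|_] := eqVneq nu la; first by left.
  by rewrite mul0r addr0 => /c_la; right.
Qed.

End Expansion.

(** * Supercharacter values as products over arcs, and the determinant *)

Lemma sp_dimE la : sp_dim la =
  (\sum_(a in arcs la) (a.2 - a.1).-1 + #|arcs la|)%N.
Proof.
rewrite -sum1_card -big_split; apply: eq_bigr => -[i j] /setpart_lt /=; lia.
Qed.

Lemma supercharacter_valueE (m : nat) la mu :
  supercharacter_value m la mu =
  \prod_(a in arcs la) arc_factor (m%:R : algC) mu a.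
Proof.
rewrite /supercharacter_value compatibleE; case: ifPn => [/forall_inP comp | ].
  under eq_bigr => a la_a.
    rewrite /arc_factor ifF; last first.
      apply/negbTE; rewrite negb_exists_in; exact: comp.
    over.
  rewrite !big_split /= prodfV prodrXr -nst_sum prodrXr; congr (_ / _).
  rewrite sp_dimE addnK mulrAC; congr (_ * _).
  rewrite (big_setID (arcs mu)) /= mulrC; congr (_ * _).
    by rewrite -prodr_const; apply: eq_bigr => a; rewrite inE => /andP[_ ->].
  rewrite -cardsD -prodr_const; apply: eq_bigr => a.
  by rewrite inE => /andP[/negPf-> _].
rewrite negb_forall_in => /exists_inP[a la_a].
rewrite negb_forall_in => /exists_inP[b mu_b]; rewrite negbK => ab.
rewrite (bigD1 a) //= /arc_factor ifT ?mul0r //.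
by apply/exists_inP; exists b.
Qed.

End SetPartitions.

Theorem corollary4p2 (F : finFieldType) (n : nat) (n_ge1 : (1 <= n)%N)
    (e : 'I_#|{: setpart n}| -> setpart n) (e_bij : bijective e) :
  \det (supercharacter_table F e) =
    (-1) ^+ (\sum_(la : setpart n) #|arcs la|)%N
    * (#|F|%:R : algC)
        ^ (\sum_(la : setpart n) ((sp_dim la)%:Z - (nst la la)%:Z)).
Proof.
set q : algC := #|F|%:R.
have q_neq0 : q != 0 by rewrite pnatr_eq0 -lt0n; apply/card_gt0P; exists 0.
have [c cP] := fin_all_exists (prod_arc_factor_expansion q_neq0 (n := n)).
pose A := \matrix_(i, j) c (e i) (e j).
pose W := \matrix_(i, j) qpower_sum q (arcs (e i)) (e j).
have -> : supercharacter_table F e = A *m W.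
  apply/matrixP => i j; rewrite !mxE supercharacter_rep supercharacter_valueE.
  have [-> _ _] := cP (e i); rewrite (reindex e) /=; last exact: onW_bij.
  by apply: eq_bigr => k _; rewrite !mxE.
rewrite det_mulmx (@det_ranked _ _ A (fun i => code (e i))); last first.
  move=> i j; rewrite mxE; have [_ _ cij] := cP (e i).
  by case/cij => [/(bij_inj e_bij)->|]; [left | right].
(* Nonzero entries of [W] lead to larger set partitions, so the decreasing rank counts the absent
   pairs. *)
rewrite (@det_ranked _ _ W (fun i => #|{: 'I_n * 'I_n}| - #|arcs (e i)|)%N);
  last first.
  move=> i j; rewrite mxE qpower_sum_neq0 // => sub.
  have [eq_card|neq_card] := eqVneq #|arcs (e i)| #|arcs (e j)|.
    left; apply/(bij_inj e_bij)/val_inj/eqP.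
    by rewrite eqEcard sub /= eq_card.
  have lt_ij : (#|arcs (e i)| < #|arcs (e j)|)%N.
    by rewrite ltn_neqAle neq_card subset_leq_card.
  by right; rewrite ltn_sub2l // (leq_trans lt_ij (max_card _)).
rewrite -big_split /=.
have -> : \prod_i (A i i * W i i) =
    \prod_(la : setpart n)
      ((-1) ^+ #|arcs la| * q ^ ((sp_dim la)%:Z - (nst la la)%:Z)).
  rewrite [RHS](reindex e) /=; last exact: onW_bij.
  apply: eq_bigr => i _; rewrite !mxE qpower_sum_diag //.
  have [_ -> _] := cP (e i); rewrite prodrN prodrXr -/(sp_dim _) -mulrA.
  by rewrite expfzDr // -exprnN exprnP.
rewrite big_split /= prodrXr; congr (_ * _).
by apply/esym/(big_morph (fun z => q ^ z)) => // x y; rewrite expfzDr.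
Qed.
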